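(* Suppose Assumptions 1 and 2 hold, $U$ is concave (as well as continuous and strictly increasing), and the derivative $U'(0)$ exists (finite). Let $\bar v(t,\lambda)=U(e^{-\alpha t}\bar c/\alpha+\lambda)$. Then: (a) $V_\infty$ is the unique solution of $v=Tv$ in $B([0,\infty)\times E\times[0,\infty))$. Moreover $T^nU\uparrow V_\infty$ and $T^n\bar v\downarrow V_\infty$ pointwise as $n\to\infty$. (b) There exists a minimizer $f^*\in F$ of $V_\infty$ (i.e. $TV_\infty=T_{f^*}V_\infty$), and the stationary policy $(f^*,f^*,\dots)$ is optimal for the infinite horizon problem, i.e. $V_{f^*}=V_\infty$; in particular it attains $J_\infty(i)=V_\infty(0,i,0)$ for all $i\in E$.
   Context: Semi-Markov decision model: $E=\{1,2,\dots\}$ countable state space; $A$ a Borel action space; $A(i)\subseteq A$ Borel sets of admissible actions, $K=\{(i,a):i\in E,a\in A(i)\}$. $Q(\cdot,\cdot\mid i,a)$ is a semi-Markov kernel on $[0,\infty)\times E$ given $K$ with $Q(0,j\mid i,a)=0$: $Q(t,j\mid i,a)$ is the probability that the sojourn time in $i$ under action $a$ is $\le t$ and the next state is $j$. $C:K\to[0,\bar c]$ measurable running cost with $0<\bar c<\infty$; $\alpha>0$ discount factor; $U:[0,\infty)\to\mathbb R$ continuous and strictly increasing. Augmented model: state $(t,i,\lambda)\in[0,\infty)\times E\times[0,\infty)$; under action $a\in A(i)$ the next state is $(t+s,j,\lambda+\frac{C(i,a)}{\alpha}(e^{-\alpha t}-e^{-\alpha(t+s)}))$ with $(s,j)\sim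 Q(ds,j\mid i,a)$. Policies choose actions in $A(i_n)$ measurably from the augmented history; $F$ is the set of measurable $f:[0,\infty)\times E\times[0,\infty)\to A$ with $f(t,i,\lambda)\in A(i)$; a stationary policy uses one $f\in F$ at every step. For initial $(T_0,X_0,C_0)=(t,i,\lambda)$ and policy $\pi$, $C_n=\lambda+\sum_{k=0}^{n-1}\frac{C(X_k,A_k)}{\alpha}(e^{-\alpha T_k}-e^{-\alpha T_{k+1}})$ and $C_\infty=\lim_nC_n$. Define $V_{\infty\pi}(t,i,\lambda)=\mathbb E^\pi_{(t,i,\lambda)}[U(C_\infty)]$, $V_\infty=\inf_\pi V_{\infty\pi}$ over all history-dependent policies, $V_f=V_{\infty\pi}$ for the stationary policy $\pi=(f,f,\dots)$. The original problem is $J_\infty(i)=\inf_\pi\mathbb E^\pi_i[U(\int_0^\infty e^{-\alpha u}C(X(u),A(u))du)]=V_\infty(0,i,0)$. $B([0,\infty)\times E\times[0,\infty))$ is the set of measurable $v:[0,\infty)\times E\times[0,\infty)\to\mathbb R$ with $U(\lambda)\le v(t,i,\lambda)\le U(e^{-\alpha t}\bar c/\alpha+\lambda)$. For such $v$ and $f\in F$: $T_fv(t,i,\lambda)=\sum_j\int v(t+s,j,\lambda+\frac{C(i,f(t,i,\lambda))}{\alpha}(e^{-\alpha t}-e^{-\alpha(t+s)}))Q(ds,j\mid i,f(t,i,\lambda))$ and $Tv(t,i,\lambda)=\inf_{a\in A(i)}\sum_j\int v(t+s,j,\lambda+\frac{C(i,a)}{\alpha}(e^{-\alpha t}-e^{-\alpha(t+s)}))Q(ds,j\mid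 i,a)$; $f$ is a minizer of $v$ if $Tv=T_fv$. Functions of $(t,\lambda)$ or $\lambda$ alone are viewed as functions on $[0,\infty)\times E\times[0,\infty)$. Assumption 1: there exist $\delta,\epsilon>0$ with $\sup_{(i,a)\in K}Q(\delta,E\mid i,a)\le1-\epsilon$. Assumption 2: for each $(t,i,\lambda)$: (i) $A(i)$ compact; (ii) $a\mapsto C(i,a)$ continuous on $A(i)$; (iii) for each $v\in B([0,\infty)\times E\times[0,\infty))$, $a\mapsto\sum_j\int v(t+s,j,\lambda+\frac{C(i,a)}{\alpha}(e^{-\alpha t}-e^{-\alpha(t+s)}))Q(ds,j\mid i,a)$ is continuous on $A(i)$. *)

(* Defs.v *)
From HB Require Import structures.
From mathcomp Require Import all_boot all_order all_algebra.
From mathcomp Require Import all_classical all_reals all_analysis.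
From mathcomp Require Import measurable_realfun.

Set Implicit Arguments.
Unset Strict Implicit.
Unset Printing Implicit Defensive.

Import Order.TTheory GRing.Theory Num.Theory.
Import numFieldNormedType.Exports.

Local Open Scope classical_set_scope.
Local Open Scope ring_scope.

Definition borel (P : ptopologicalType) := g_sigma_algebraType (@open P).

(* A Polish space: completely (pseudo)metrizable by a complete metric,
   Hausdorff (hence metric) and separable. *)
Definition polish {R : realType} (P : completePseudoMetricType R) : Prop :=
  hausdorff_space P /\ exists D : set P, countable D /\ dense D.

Section SMDP.
Variable R : realType.
Variable P : completePseudoMetricType R.   (* ambient Polish space of actions *)
Variable Ai : nat -> set P.
Variable Q : nat -> P -> probability (R * nat)%type R.
  (* Q i a : joint law of (sojourn time, next state) given (i,a) *)
Variable C : nat -> P -> R.                  (* running cost *)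
Variables (alpha cbar : R).
Variable U : R -> R.

(* augmented state (t, i, lambda) *)
Definition state := (R * nat * R)%type.

Definition Dom : set state := [set x | 0 <= x.1.1 /\ 0 <= x.2].

Definition nxt (x : state) (a : P) (y : (R * nat)%type) : state :=
  (x.1.1 + y.1, y.2,
   x.2 + C x.1.2 a / alpha * (expR (- alpha * x.1.1) - expR (- alpha * (x.1.1 + y.1)))).

Definition Qint (v : state -> R) (x : state) (a : P) : R :=
  fine (\int[Q x.1.2 a]_(y in [set: (R * nat)%type]) (v (nxt x a y))%:E)%E.

Definition Tf (f : state -> P) (v : state -> R) : state -> R :=
  fun x => Qint v x (f x).

Definition Top (v : state -> R) : state -> R :=
  fun x => inf [set Qint v x a | a in Ai x.1.2].

Definition Ulow : state -> R := fun x => U x.2.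
Definition vbar : state -> R := fun x => U (expR (- alpha * x.1.1) * cbar / alpha + x.2).

Definition inB (v : state -> R) : Prop :=
  measurable_fun Dom v /\
  forall x, Dom x -> Ulow x <= v x <= vbar x.

(* the set F of decision rules (extended, harmlessly, to all of R x nat x R:
   any rule on [0,oo) x E x [0,oo) extends to such an f) *)
Definition inF (f : state -> P) : Prop :=
  measurable_fun [set: state] (f : state -> borel P) /\
  forall x, Ai x.1.2 (f x).

(* histories h_n = ((x_0,a_0),...,(x_{n-1},a_{n-1}), x_n) *)
Definition hist (n : nat) := (n.-tuple (state * borel P)%type * state)%type.

Definition policy := forall n : nat, hist n -> borel P.

Definition admissible (pi : policy) : Prop :=
  forall n, measurable_fun [set: hist n] (pi n) /\
            forall h : hist n, Ai h.2.1.2 (pi n h).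

Definition ext (n : nat) (h : hist n) (a : P) (y : (R * nat)%type) : hist n.+1 :=
  ([tuple of rcons h.1 (h.2, (a : borel P))], nxt h.2 a y).

(* EU pi m n h = E^pi[ U(C_{n+m}) | history h_n ]  (C_k = lambda-component
   of the k-th augmented state) *)
Fixpoint EU (pi : policy) (m : nat) : forall n, hist n -> R :=
  match m with
  | 0 => fun n h => U h.2.2
  | m'.+1 => fun n h =>
      fine (\int[Q h.2.1.2 (pi n h)]_(y in [set: (R * nat)%type])
              (EU pi m' (ext h (pi n h) y))%:E)%E
  end.

Definition hist0 (x : state) : hist 0 := ([tuple], x).

(* V_{oo,pi}(x) = E^pi_x[U(C_oo)] = lim_n E^pi_x[U(C_n)] (monotone convergence) *)
Definition Vpi (pi : policy) (x : state) : R :=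
  lim ((fun n => EU pi n (hist0 x)) @ \oo).

Definition Vinf (x : state) : R := inf [set Vpi pi x | pi in admissible].

Definition stationary (f : state -> P) : policy := fun n h => (f h.2 : borel P).

Definition Vf (f : state -> P) : state -> R := Vpi (stationary f).

Definition Jinf (i : nat) : R := Vinf (0, i, 0).

End SMDP.

(* Main.v *)
Require Import Defs.
From HB Require Import structures.
From mathcomp Require Import all_boot all_order all_algebra.
From mathcomp Require Import all_classical all_reals all_analysis.
From mathcomp Require Import measurable_realfun.
From mathcomp Require Import ring lra.
Import Order.TTheory GRing.Theory Num.Theory.
Import numFieldNormedType.Exports.
Local Open Scope classical_set_scope.
Local Open Scope ring_scope.

(** The operator T is monotone and satisfies T v - k beta e^{-alpha t} <= T w
    whenever v - k e^{-alpha t} <= w, where beta < 1 comes from Assumption 1: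
    with probability at least eps the sojourn time exceeds delta, in which case
    the discount shrinks by e^{-alpha delta}. By concavity U is Lipschitz with
    constant U'(0), so the two bounds of B differ by at most K e^{-alpha t};
    hence T^n vbar - T^n U <= K beta^n e^{-alpha t}, both sequences have one
    common limit V, and V is the only fixed point of T in B. Every policy
    satisfies E^pi U(C_n) >= T^n U, so V bounds all values from below, and for
    a minimizer f of V the value of (f, f, ...) is squeezed between
    V - K beta^n e^{-alpha t} and V. Measurability of T v and of a minimizer
    reduces, by separability, to countably many fixed actions.

    Expectations under a policy are never shown to be measurable in the history:
    only monotonicity of the integral is used for them, and this holds for
    arbitrary integrands. *)

Set Implicit Arguments.
Unset Strict Implicit.
Unset Printing Implicit Defensive.

(** * Integrals of possibly non-measurable functions *)

Section lower_integral.
Import HBNNSimple.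
Context d (T : measurableType d) (R : realType).
Variable mu : {measure set T -> \bar R}.
Variable N : set T.
Hypotheses (mN : measurable N) (muN : mu N = 0%E).
Local Open Scope ereal_scope.

(** A simple function below [f] need not lie below [g] on [N]. Multiplying it by the indicator of
    the complement of [N] repairs this and keeps its integral, since [N] is null; the suprema then
    compare. *)
Lemma ge0_le_integral_offnull (f g : T -> \bar R) :
  (forall x, 0 <= f x) -> (forall x, 0 <= g x) ->
  (forall x, ~ N x -> f x <= g x) ->
  \int[mu]_x f x <= \int[mu]_x g x.
Proof.
move=> f0 g0 fg; rewrite !ge0_integralTE//.
apply: ge_ereal_sup => _ [h /= hf <-].
pose h' := proj_nnsfun h (measurableC mN).
have -> : sintegral mu h = sintegral mu h'.
  have sintE (k : {nnsfun T >-> R}) : sintegral mu k = \int[mu]_x (k x)%:E.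
    by rewrite integral_nnsfun// patch_setT.
  rewrite !sintE.
  have restrictN (k : {nnsfun T >-> R}) :
      \int[mu]_x (k x)%:E = \int[mu]_(x in setT `\` N) (k x)%:E.
    apply: (ge0_negligible_integral mN) => //; first exact/measurable_EFinP.
    by move=> x _; rewrite lee_fin.
  rewrite !restrictN.
  apply: eq_integral => x; rewrite inE => -[_ Nx].
  by rewrite /h' /proj_nnsfun/= mindicE mem_set//= mulr1.
apply: ereal_sup_ubound; exists h' => //= x.
rewrite /h' /proj_nnsfun/= mindicE; have [xN|xN] := boolP (x \in _).
  by rewrite mulr1 (le_trans (hf x))// fg//; exact/set_mem.
by rewrite mulr0.
Qed.

(* No measurability is required: the integral of an arbitrary nonnegative
   function is the supremum of the integrals of the simple functions below
   it. *)
Lemma le_integral_offnull (f g : T -> \bar R) :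
  (forall x, ~ N x -> f x <= g x) -> \int[mu]_x f x <= \int[mu]_x g x.
Proof.
move=> fg; rewrite integralE [leRHS]integralE leeB//.
- apply: ge0_le_integral_offnull => // x Nx.
  by rewrite !funeposE; apply: le_max2 => //; exact: fg.
- apply: ge0_le_integral_offnull => // x Nx.
  by rewrite !funenegE; apply: le_max2 => //; rewrite leeN2; exact: fg.
Qed.

End lower_integral.

Section lower_expectation.
Context d (T : measurableType d) (R : realType).
Variable mu : probability T R.
Variable N : set T.
Hypotheses (mN : measurable N) (muN : mu N = 0%E).

Let measT : (mu : {measure set T -> \bar R}) setT = 1%E.
Proof. exact: probability_setT. Qed.

Lemma Rintegral_probability_cst (k : R) : \int[mu]_x k = k.
Proof. by rewrite Rintegral_cst// measT mulr1. Qed.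

(** Comparison with the constants [m] and [M], which integrate to themselves under a probability,
    excludes both infinite values. *)
Lemma integral_fin_num_offnull (f : T -> R) m M :
  (forall x, ~ N x -> m <= f x <= M) -> (\int[mu]_x (f x)%:E)%E \is a fin_num.
Proof.
move=> fmM; have intE (k : R) : (\int[mu]_x k%:E = k%:E)%E.
  by rewrite integral_cst// measT mule1.
rewrite fin_numE; apply/andP; split; apply/eqP => fE.
- have := @le_integral_offnull _ _ _ mu N mN muN (cst m%:E) (EFin \o f).
  rewrite /= intE fE; suff h : forall x, ~ N x -> (m%:E <= (f x)%:E)%E.
    by move=> /(_ h); rewrite leeNy_eq.
  by move=> x /fmM /andP[]; rewrite lee_fin.
- have := @le_integral_offnull _ _ _ mu N mN muN (EFin \o f) (cst M%:E).
  rewrite /= intE fE; suff h : forall x, ~ N x -> ((f x)%:E <= M%:E)%E.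
    by move=> /(_ h); rewrite leye_eq.
  by move=> x /fmM /andP[]; rewrite lee_fin.
Qed.

Lemma le_Rintegral_offnull (f g : T -> R) m M :
  (forall x, ~ N x -> m <= f x) -> (forall x, ~ N x -> f x <= g x) ->
  (forall x, ~ N x -> g x <= M) -> \int[mu]_x f x <= \int[mu]_x g x.
Proof.
move=> mf fg gM; rewrite /Rintegral; apply: fine_le.
- apply: (@integral_fin_num_offnull _ m M) => x Nx.
  by rewrite mf// (le_trans (fg x Nx)) ?gM.
- apply: (@integral_fin_num_offnull _ m M) => x Nx.
  by rewrite gM// (le_trans (mf x Nx)) ?fg.
- by apply: (le_integral_offnull mN muN) => x Nx; rewrite lee_fin fg.
Qed.

Lemma Rintegral_bounds_offnull (f : T -> R) m M :
  (forall x, ~ N x -> m <= f x <= M) -> m <= \int[mu]_x f x <= M.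
Proof.
move=> fmM; rewrite -[X in X <= _ <= _]Rintegral_probability_cst.
rewrite -[X in _ <= _ <= X]Rintegral_probability_cst.
by apply/andP; split; apply: (@le_Rintegral_offnull _ _ m M) => // x /fmM /andP[].
Qed.

Lemma eq_Rintegral_offnull (f g : T -> R) m M :
  (forall x, ~ N x -> m <= f x <= M) -> (forall x, ~ N x -> f x = g x) ->
  \int[mu]_x f x = \int[mu]_x g x.
Proof.
move=> fmM fg; apply/eqP; rewrite eq_le; apply/andP; split;
  apply: (@le_Rintegral_offnull _ _ m M) => x Nx;
  by rewrite -?fg//; have /andP[] := fmM x Nx.
Qed.

(** Additivity, unlike monotonicity, relies on measurability. Setting [f] and [g] to zero on [N]
    makes them bounded and measurable on the whole space, hence integrable, and changes no
    integral. *)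
Lemma Rintegral_linear_offnull (f g : T -> R) k m M m' M' :
  measurable_fun (~` N) f -> measurable_fun (~` N) g ->
  (forall x, ~ N x -> m <= f x <= M) -> (forall x, ~ N x -> m' <= g x <= M') ->
  \int[mu]_x (f x + k * g x) = \int[mu]_x f x + k * \int[mu]_x g x.
Proof.
have patchE (h : T -> R) x : ~ N x -> (h \_ (~` N)) x = h x.
  by move=> Nx; rewrite patchE mem_set.
have integrable_patch (h : T -> R) a b : measurable_fun (~` N) h ->
    (forall x, ~ N x -> a <= h x <= b) ->
    mu.-integrable setT (EFin \o (h \_ (~` N))).
  move=> mh hab; apply: measurable_bounded_integrable => //.
  - by rewrite measT ltry.
  - by rewrite -measurable_restrictT//; exact: measurableC.
  - exists (`|a| + `|b|); split; first by rewrite num_real.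
    move=> c /ltW abc x _; apply: le_trans abc.
    have [Nx|Nx] := pselect (N x).
      by rewrite /= patchN ?normr0 ?addr_ge0// notin_setE => /(_ Nx).
    rewrite /= patchE//; have /andP[ah hb] := hab x Nx.
    have := ler_norm b; have := ler_norm (- a); rewrite normrN.
    by have := normr_ge0 a; have := normr_ge0 b; rewrite ler_norml; lra.
move=> mf mg fmM gmM.
pose f' := f \_ (~` N); pose g' := g \_ (~` N).
have if' := integrable_patch _ _ _ mf fmM.
have ig' := integrable_patch _ _ _ mg gmM.
rewrite (@eq_Rintegral_offnull f f' m M)//; last by move=> x Nx; rewrite /f' patchE.
rewrite (@eq_Rintegral_offnull g g' m' M')//; last by move=> x Nx; rewrite /g' patchE.
rewrite -RintegralZl// -RintegralD//; last first.
  by rewrite (_ : _ \o _ = (fun x => k%:E * (g' x)%:E)%E)//; exact: integrableZl.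
apply: (@eq_Rintegral_offnull _ _ (m - `|k| * (`|m'| + `|M'|)) (M + `|k| * (`|m'| + `|M'|))).
- move=> x Nx; have /andP[mfx fMx] := fmM x Nx.
  have : `|k * g x| <= `|k| * (`|m'| + `|M'|).
    rewrite normrM ler_wpM2l// ler_norml; have := gmM x Nx.
    by have := ler_norm M'; have := ler_norm (- m'); rewrite normrN;
       have := normr_ge0 m'; have := normr_ge0 M'; lra.
  by rewrite ler_norml; lra.
- by move=> x Nx; rewrite /f' /g' !patchE.
Qed.

End lower_expectation.

(** * Measurable selection of minimizers *)

(* The enumeration consists of the interiors of the balls of radius 1/(l+1)
   centered at the k-th point of a countable dense set. *)
Lemma polish_basis (R : realType) (P : completePseudoMetricType R) :
  polish P -> exists O : nat -> set P, (forall n, open (O n)) /\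
    forall x V, nbhs x V -> exists n, O n x /\ O n `<=` V.
Proof.
move=> [_ [D [/countable_injP[idx idxI] denseD]]].
pose B (p : nat * nat) : set P :=
  \bigcup_(c in [set c | D c /\ idx c = p.1]) (ball c p.2.+1%:R^-1)°.
exists (fun n => if unpickle n is Some p then B p else set0); split.
  move=> n; case: unpickle => [p|]; last exact: open0.
  by apply: bigcup_open => c _; exact: open_interior.
move=> x V /nbhs_ballP[e /= e0 eV].
have [l _ le] : exists2 l : nat, True & l.+1%:R^-1 < e / 2.
  have [l] := @ltr_add_invr R 0 (e / 2) (divr_gt0 e0 (ltr0Sn _ _)).
  by rewrite add0r => ?; exists l.
have r0 : 0 < l.+1%:R^-1 / 2 :> R by rewrite divr_gt0.
(* The centre [c] is taken within half the radius of [x], so that [x] is interior to the ball around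
   [c]; the radius is below [e / 2], so that this ball stays inside [V]. *)
have [|c [/interior_subset xc Dc]] :=
    denseD (ball x (l.+1%:R^-1 / 2))° _ (@open_interior _ _).
  by exists x; exact: nbhsx_ballx.
exists (pickle (idx c, l)); rewrite pickleK; split.
  exists c => //=; apply/nbhs_ballP; exists (l.+1%:R^-1 / 2) => // y xy.
  by rewrite (splitr l.+1%:R^-1); apply: ball_triangle xy; exact: ball_sym.
move=> y [c' [/= Dc' idxE]]; rewrite (idxI _ _ _ _ idxE) ?inE// => /interior_subset cy.
apply: eV; rewrite (splitr e); apply: ball_triangle (le_ball (ltW le) cy).
by apply: le_ball xc; move: (l.+1%:R^-1) le r0 => r; lra.
Qed.

Section caratheodory.
Context d (T : measurableType d) (R : realType) (P : ptopologicalType).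
Variable O : nat -> set P.
Hypotheses (oO : forall n, open (O n))
  (basisO : forall x V, nbhs x V -> exists n, O n x /\ O n `<=` V).

(** One point is chosen in each basic open set that meets [K]; for the others the fixed point [k0]
    of [K] serves as default. *)
Lemma dense_sequence (K : set P) : K !=set0 ->
  exists a : nat -> P, (forall n, K (a n)) /\
    forall x V, K x -> nbhs x V -> exists n, V (a n).
Proof.
move=> [k0 Kk0].
have [a aP] : {a : nat -> P & forall n, K (a n) /\
    ((K `&` O n) !=set0 -> O n (a n))}.
  apply: (@choice _ _ (fun n c => K c /\ ((K `&` O n) !=set0 -> O n c))) => n.
  have [[c [Kc Oc]]|KO] := pselect ((K `&` O n) !=set0); first by exists c.
  by exists k0; split.
exists a; split=> [n|x V Kx /basisO[n [Ox OV]]]; first by have [] := aP n.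
by exists n; apply: OV; have [_] := aP n; apply; exists x.
Qed.

(** By continuity the infimum over [K] equals the infimum over a sequence dense in [K], which is a
    countable infimum of measurable functions. Compactness provides a minimizer, hence the lower
    bounds that [inf] requires. *)
Lemma measurable_fun_inf_compact (D : set T) (K : set P) (phi : T -> P -> R) :
  K !=set0 -> compact K ->
  (forall a, K a -> measurable_fun D (phi ^~ a)) ->
  (forall x, D x -> {within K, continuous (phi x)}) ->
  measurable_fun D (fun x => inf [set phi x a | a in K]).
Proof.
move=> K0 cK mphi cphi; have [a [Ka denseK]] := dense_sequence K0.
apply: (eq_measurable_fun (fun x => infs (fun n => phi x (a n)) 0%N)); last first.
  apply: measurable_fun_infs => [x Dx|n]; last exact: mphi.
  have [c cK' cmin] := compact_EVT_min K0 cK (cphi x Dx).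
  by exists (phi x c) => _ [n _ <-]; apply: cmin; rewrite inE.
move=> x; rewrite inE => Dx.
have [c /set_mem Kc cmin] := compact_EVT_min K0 cK (cphi x Dx).
have infE : inf [set phi x b | b in K] = phi x c.
  apply/eqP; rewrite eq_le; apply/andP; split.
    apply: ge_inf; last by exists c.
    by exists (phi x c) => _ [b Kb <-]; apply: cmin; rewrite inE.
  apply: lb_le_inf; first by exists (phi x c), c.
  by move=> _ [b Kb <-]; apply: cmin; rewrite inE.
rewrite infE /infs; apply/eqP; rewrite eq_le; apply/andP; split; last first.
  apply: lb_le_inf; first by exists (phi x (a 0%N)), 0%N.
  by move=> _ [n _ <-]; apply: cmin; rewrite inE.
apply/ler_addgt0Pr => e e0.
have /subspace_continuousP/(_ c Kc)/cvgrPdist_lt/(_ e e0) := cphi x Dx.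
rewrite near_withinE => nearc.
have [n /= /(_ (Ka n)) dist] := denseK _ _ Kc nearc.
apply: (@le_trans _ _ (phi x (a n))).
  apply: ge_inf; last by exists n.
  by exists (phi x c) => _ [m _ <-]; apply: cmin; rewrite inE.
by rewrite -lerBlDl (le_trans (ler_norm _))// distrC ltW.
Qed.

Section selection.
Variables (D : set T) (K : set P) (phi : T -> P -> R).
Hypotheses (hP : hausdorff_space P) (mD : measurable D) (K0 : K !=set0)
  (cK : compact K).
Hypothesis mphi : forall a, K a -> measurable_fun D (phi ^~ a).
Hypothesis cphi : forall x, D x -> {within K, continuous (phi x)}.

Let argmin x : set P := [set a | K a /\ forall b, K b -> phi x a <= phi x b].

Let closedK : closed K. Proof. exact: compact_closed. Qed.

Let argminE x c : D x -> argmin x c -> phi x c = inf [set phi x a | a in K].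
Proof.
move=> Dx [Kc cmin]; apply/eqP; rewrite eq_le; apply/andP; split.
  apply: lb_le_inf; first by exists (phi x c), c.
  by move=> _ [b Kb <-]; exact: cmin.
apply: ge_inf; last by exists c.
by exists (phi x c) => _ [b Kb <-]; exact: cmin.
Qed.

Let argmin0 x : D x -> argmin x !=set0.
Proof.
move=> Dx; have [c /set_mem Kc cmin] := compact_EVT_min K0 cK (cphi Dx).
by exists c; split => // b Kb; apply: cmin; rewrite inE.
Qed.

(** A minimizer lies in [F] exactly when the minimum over [K] intersected with [F] does not exceed
    the minimum over [K], and both minima are measurable in [x]. *)
Let measurable_argmin F : closed F ->
  measurable (D `&` [set x | (argmin x `&` F) !=set0]).
Proof.
move=> cF; have [KF0|KF0] := pselect ((K `&` F) !=set0); last first.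
  rewrite (_ : _ `&` _ = set0)// -subset0 => x [_ [c [[Kc _] Fc]]].
  by apply: KF0; exists c.
have cphiF x : D x -> {within K `&` F, continuous (phi x)}.
  by move=> /cphi; apply: continuous_subspaceW; exact: subIsetl.
have cKF : compact (K `&` F) by exact: compact_closedI.
have mK := measurable_fun_inf_compact K0 cK mphi cphi.
have mKF := measurable_fun_inf_compact KF0 cKF
  (fun a h => mphi (proj1 h)) cphiF.
have -> : D `&` [set x | (argmin x `&` F) !=set0] =
    D `&` (fun x => inf [set phi x a | a in K `&` F] <=
                    inf [set phi x a | a in K]) @^-1` [set true].
  apply/seteqP; split=> x [Dx h]; split => //=.
    have [c [ac Fc]] := h; rewrite -(argminE Dx ac).
    have [Kc cmin] := ac.
    apply: ge_inf; last by exists c.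
    by exists (phi x c) => _ [b [Kb _] <-]; exact: cmin.
  have [c /set_mem[Kc Fc] cmin] := compact_EVT_min KF0 cKF (cphiF x Dx).
  exists c; split => //; split => // b Kb.
  have h1 : phi x c <= inf [set phi x a | a in K `&` F].
    apply: lb_le_inf; first by exists (phi x c), c.
    by move=> _ [b' KFb <-]; apply: cmin; rewrite inE.
  rewrite (le_trans h1)// (le_trans h)//; apply: ge_inf; last by exists b.
  have [c' [Kc' c'min]] := argmin0 Dx.
  by exists (phi x c') => _ [b' Kb' <-]; exact: c'min.
by apply: measurable_fun_ler.
Qed.

Let G n : set P := ~` O n.
Let closedG n : closed (G n). Proof. exact: open_closedC. Qed.

(* Intersecting successively with the members of a countable family of closed
   sets that separates points, whenever the result stays nonempty, shrinks the
   set of minimizers to a single point. *)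
Fixpoint argmin_refine n x : set P :=
  if n is m.+1 then
    if pselect ((argmin_refine m x `&` G m) !=set0) then
      argmin_refine m x `&` G m else argmin_refine m x
  else argmin x.

Let refine_in n x : (argmin_refine n x `&` G n) !=set0 ->
  argmin_refine n.+1 x = argmin_refine n x `&` G n.
Proof. by move=> h /=; case: pselect. Qed.

Let refine_out n x : ~ ((argmin_refine n x `&` G n) !=set0) ->
  argmin_refine n.+1 x = argmin_refine n x.
Proof. by move=> h /=; case: pselect. Qed.

Let refineS n x : argmin_refine n.+1 x `<=` argmin_refine n x.
Proof.
have [h|h] := pselect ((argmin_refine n x `&` G n) !=set0).
  by rewrite refine_in//; exact: subIsetl.
by rewrite refine_out.
Qed.

Let refine_mono m n x : (m <= n)%N -> argmin_refine n x `<=` argmin_refine m x.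
Proof.
elim: n => [|n ih]; first by rewrite leqn0 => /eqP ->.
rewrite leq_eqVlt => /predU1P[->//|/ih]; exact: (subset_trans (@refineS _ _)).
Qed.

Let refine0 n x : D x -> argmin_refine n x !=set0.
Proof.
move=> Dx; elim: n => [|n ih]; first exact: argmin0.
have [h|h] := pselect ((argmin_refine n x `&` G n) !=set0).
  by rewrite refine_in.
by rewrite refine_out.
Qed.

(** The induction ranges over all closed [F]: whether stage [n.+1] meets [F] is decided by whether
    stage [n] meets [G n], and then by whether it meets [G n] intersected with [F], or else [F]
    alone. *)
Let measurable_refine n F : closed F ->
  measurable (D `&` [set x | (argmin_refine n x `&` F) !=set0]).
Proof.
elim: n F => [|n ih] F cF; first exact: measurable_argmin.
rewrite (_ : _ `&` _ =
  ((D `&` [set x | (argmin_refine n x `&` G n) !=set0]) `&`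
   (D `&` [set x | (argmin_refine n x `&` (G n `&` F)) !=set0])) `|`
  ((D `&` [set x | (argmin_refine n x `&` F) !=set0]) `\`
   (D `&` [set x | (argmin_refine n x `&` G n) !=set0]))).
  apply: measurableU.
    by apply: measurableI; apply: ih => //; exact: closedI.
  by apply: measurableD; exact: ih.
apply/seteqP; split=> x.
  move=> [Dx hF]; have {hF} : (argmin_refine n.+1 x `&` F) !=set0 := hF.
  have [h|h] := pselect ((argmin_refine n x `&` G n) !=set0).
    by rewrite refine_in// -setIA => hF; left.
  by rewrite refine_out// => hF; right; split => // -[_ /h].
move=> xF; suff : D x /\ (argmin_refine n.+1 x `&` F) !=set0 by [].
case: xF => [[[Dx h] [_ hF]]|[[Dx hF] nh]]; split => //.
  by rewrite refine_in// -setIA.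
by rewrite refine_out// => h; exact: nh.
Qed.

(** The minimizers form a sublevel set of a function continuous only on [K]; it is the trace on [K]
    of a closed set, and [K] itself is closed. *)
Let closed_argmin x : D x -> closed (argmin x).
Proof.
move=> Dx; have -> : argmin x =
    K `&` [set a | phi x a <= inf [set phi x a | a in K]].
  apply/seteqP; split=> [a ac|a [Ka am]].
    by split; [case: ac|rewrite /= (argminE Dx ac)].
  have [c ac] := argmin0 Dx; split => // b Kb; rewrite (le_trans am)//.
  by rewrite -(argminE Dx ac); exact: ac.2.
have : closed ([set a | phi x a <= inf [set phi x a | a in K]] : set (subspace K)).
  by apply: (@closed_comp _ _ (phi x : subspace K -> R)
    [set r | r <= inf [set phi x a | a in K]]); [move=> ? _; exact: cphi|exact: closed_le].
move=> /closed_subspaceP[V cV VK]; rewrite setIC -VK.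
exact: closedI.
Qed.

Let closed_refine n x : D x -> closed (argmin_refine n x).
Proof.
move=> Dx; elim: n => [|n ih]; first exact: closed_argmin.
have [h|h] := pselect ((argmin_refine n x `&` G n) !=set0).
  by rewrite refine_in//; exact: closedI.
by rewrite refine_out.
Qed.

(** Points chosen in the successive stages within [F] have a cluster point in the compact set [K].
    Each stage is closed and contains all later points, so it contains the cluster point. *)
Let refine_limit x F : D x -> closed F ->
  (forall n, (argmin_refine n x `&` F) !=set0) ->
  exists c, F c /\ forall n, argmin_refine n x c.
Proof.
move=> Dx cF hF.
have [c cP] : {c : nat -> P & forall n, argmin_refine n x (c n) /\ F (c n)}.
  apply: (@choice _ _ (fun n c => argmin_refine n x c /\ F c)) => n.
  by have [c ?] := hF n; exists c.
have subK n : argmin_refine n x `<=` K.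
  by apply: (subset_trans (@refine_mono 0%N n x (leq0n n))) => a [].
have [p [Kp clp]] : (K `&` cluster (c @ \oo)) !=set0.
  by apply: cK; exists 0%N => // n _; apply: (subK n); have [] := cP n.
have inclosed S n : closed S -> (forall m, (n <= m)%N -> S (c m)) -> S p.
  by move=> cS Sc; apply: cS => B /clp; apply; exists n.
exists p; split; first by apply: (inclosed F 0%N) => // m _; have [] := cP m.
move=> n; apply: (inclosed _ n); first exact: closed_refine.
by move=> m nm; apply: (refine_mono nm); have [] := cP m.
Qed.

(** If [a] and [b] differ, some [O n] contains [b] but not [a]. Then [a] witnesses that stage [n]
    meets [G n], so stage [n.+1] is cut down to [G n] and loses [b]. *)
Let refine_unique x a b : (forall n, argmin_refine n x a) ->
  (forall n, argmin_refine n x b) -> a = b.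
Proof.
move=> ra rb; apply: contrapT => ab.
have nV : nbhs b (~` [set a]).
  apply: open_nbhs_nbhs; split; last by move=> /= ba; apply: ab; rewrite ba.
  by apply/closed_openC/accessible_closed_set1/hausdorff_accessible.
have [n [Ob OV]] := basisO nV.
have : (argmin_refine n x `&` G n) !=set0.
  by exists a; split; [exact: ra|move=> /OV; apply].
by move=> /refine_in rE; have := rb n.+1; rewrite rE => -[_]; apply.
Qed.

(** The selection is the single point common to all stages. By [refine_limit] and uniqueness it
    avoids [V] exactly when every stage meets the complement of [V], a countable intersection of
    measurable events. *)
Lemma measurable_minimizer : exists f : T -> P,
  (forall x, D x -> K (f x) /\ forall b, K b -> phi x (f x) <= phi x b) /\
  (forall V, open V -> measurable (D `&` f @^-1` V)).
Proof.
have refine_lim0 x : D x -> exists c, forall n, argmin_refine n x c.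
  move=> Dx; have [|c [_ ?]] := @refine_limit x setT Dx (@closedT _).
    by move=> n; rewrite setIT; exact: refine0.
  by exists c.
have [f fP] : {f : T -> P & forall x, D x -> forall n, argmin_refine n x (f x)}.
  apply: (@choice _ _ (fun x c => D x -> forall n, argmin_refine n x c)) => x.
  have [Dx|nDx] := pselect (D x); last by exists point.
  by have [c ?] := refine_lim0 x Dx; exists c.
exists f; split=> [x Dx|V oV]; first exact: (fP x Dx 0%N).
have -> : D `&` f @^-1` V = D `\`
    \bigcap_n (D `&` [set x | (argmin_refine n x `&` ~` V) !=set0]).
  apply/seteqP; split=> x [Dx h]; split => //.
    move=> hV; have [|c [nVc rc]] := @refine_limit x _ Dx (open_closedC oV).
      by move=> n; have [] := hV n.
    by apply: nVc; rewrite (refine_unique rc (fP x Dx)).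
  apply: contrapT => nV; apply: h => n _; split => //.
  by exists (f x); split => //; exact: fP.
apply: measurableD => //; apply: bigcapT_measurable => n.
by apply: measurable_refine; exact: open_closedC.
Qed.

End selection.
End caratheodory.

(** * The semi-Markov decision model *)

(** Concavity makes the slopes of chords starting at 0 decrease, so all of them are bounded by their
    limit [d] at 0; the slope over [[x, y]] is at most the slope over [[0, x]]. *)
Lemma concave_lipschitz (R : realType) (U : R -> R) (d : R) :
  (forall x y l, 0 <= x -> 0 <= y -> 0 <= l <= 1 ->
     l * U x + (1 - l) * U y <= U (l * x + (1 - l) * y)) ->
  (fun h => (U h - U 0) / h) @ 0%R^'+ --> d ->
  forall x y, 0 <= x -> x <= y -> U y - U x <= d * (y - x).
Proof.
move=> concU dU.
(* Comparison of slopes from 0 with denominators cleared: concavity is applied to [x] as the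
   combination of [y] and 0 with weight [x / y]. *)
have chord x y : 0 <= x -> x <= y -> 0 < y -> x * (U y - U 0) <= y * (U x - U 0).
  move=> x0 xy y0; have xy01 : 0 <= x / y <= 1.
    by rewrite divr_ge0 ?(ltW y0)// ler_pdivrMr// mul1r.
  have := concU y 0 (x / y) (ltW y0) (lexx 0) xy01.
  rewrite mulr0 addr0 divfK ?gt_eqF// => Ux.
  have : y * (x / y * U y + (1 - x / y) * U 0) <= y * U x by rewrite ler_pM2l.
  have -> : y * (x / y * U y + (1 - x / y) * U 0) = x * U y + (y - x) * U 0.
    by field; rewrite gt_eqF.
  by lra.
have chord0 y : 0 < y -> U y - U 0 <= d * y.
  move=> y0; rewrite -ler_pdivrMr//; apply: (cvgr_to_ge dU).
  near=> h; have h0 : 0 < h by [].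
  rewrite ler_pdivrMr// mulrAC ler_pdivlMr// mulrC [leRHS]mulrC.
  by apply: chord => //; exact: ltW.
move=> x y; rewrite le_eqVlt => /predU1P[<- |x0 xy].
  by rewrite le_eqVlt => /predU1P[<-|y0]; rewrite ?subrr ?mulr0// subr0 chord0.
rewrite -(ler_pM2l x0); have := chord x y (ltW x0) xy (lt_le_trans x0 xy).
have : (y - x) * (U x - U 0) <= (y - x) * (d * x).
  by rewrite ler_wpM2l ?subr_ge0// chord0.
by lra.
Unshelve. all: by end_near. Qed.

Section smdp.
Variables (R : realType) (P : completePseudoMetricType R) (Ai : nat -> set P).
Variables (Q : nat -> P -> probability (R * nat)%type R) (C : nat -> P -> R).
Variables (alpha cbar : R) (U : R -> R) (d : R).
Hypothesis polishP : polish P.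
Hypothesis Ai0 : forall i, Ai i !=set0.
Hypothesis Q0 : forall i a, Ai i a -> Q i a (`]-oo, 0%R] `*` [set: nat]) = 0%E.
Hypotheses (cbar0 : 0 < cbar) (alpha0 : 0 < alpha).
Hypothesis C_bounds : forall i a, Ai i a -> 0 <= C i a <= cbar.
Hypothesis cU : {within `[0%R, +oo[, continuous U}.
Hypothesis incrU : forall x y, 0 <= x -> x < y -> U x < U y.
Hypothesis lipU : forall x y, 0 <= x -> x <= y -> U y - U x <= d * (y - x).
Variables (delta eps : R).
Hypotheses (delta0 : 0 < delta) (eps0 : 0 < eps).
Hypothesis Qdelta : forall i a, Ai i a ->
  (Q i a (`]-oo, delta] `*` [set: nat]) <= (1 - eps)%:E)%E.
Hypothesis compactAi : forall i, compact (Ai i).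
Hypothesis cQint : forall v, inB alpha cbar U v ->
  forall x, Dom x -> {within Ai x.1.2, continuous (Qint Q C alpha v x)}.

Local Notation Dom := (@Dom R).
Local Notation nxt := (nxt C alpha).
Local Notation Qint := (Qint Q C alpha).
Local Notation Top := (Top Ai Q C alpha).
Local Notation vbar := (vbar alpha cbar U).
Local Notation Ulow := (Ulow U).
Local Notation inB := (inB alpha cbar U).
Local Notation Vinf := (Vinf Ai Q C alpha U).

(** The exceptional set for the integral comparisons: successors are known to stay in [Dom] only for
    positive sojourn times. *)
Let null_set : set (R * nat)%type := `]-oo, 0%R] `*` [set: nat].

Let measurable_null : measurable null_set.
Proof. exact: measurableX. Qed.

Let not_null y : ~ null_set y -> 0 < y.1.
Proof.
move=> h; rewrite ltNge; apply/negP => y0; apply: h.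
by split => //=; rewrite in_itv.
Qed.

Let leU x y : 0 <= x -> x <= y -> U x <= U y.
Proof.
by move=> x0; rewrite le_eqVlt => /predU1P[->//|/(incrU x0)/ltW].
Qed.

(** * Discounting and the bounds of B along transitions *)

Definition discount (x : state R) : R := expR (- alpha * x.1.1).

Lemma discount_bounds x : Dom x -> 0 <= discount x <= 1.
Proof.
move=> [t0 _]; rewrite expR_ge0/= -expR0 ler_expR.
by rewrite mulNr oppr_le0 mulr_ge0 ?(ltW alpha0).
Qed.

(** The added cost is at most [cbar / alpha] times the drop of the discount, which is what the
    largest possible future cost loses. So the intervals between [Ulow] and [vbar] are nested along
    a trajectory. *)
Lemma Dom_nxt x a y : Dom x -> Ai x.1.2 a -> ~ null_set y ->
  [/\ Dom (nxt x a y), x.2 <= (nxt x a y).2 &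
      discount (nxt x a y) * cbar / alpha + (nxt x a y).2
        <= discount x * cbar / alpha + x.2].
Proof.
move=> [t0 l0] Aa /not_null y0; have /andP[C0 Cc] := C_bounds Aa.
pose D := expR (- alpha * x.1.1) - expR (- alpha * (x.1.1 + y.1)).
have D0 : 0 <= D.
  by rewrite subr_ge0 ler_expR !mulNr lerN2 ler_pM2l// lerDl ltW.
have inc0 : 0 <= C x.1.2 a / alpha * D by rewrite mulr_ge0// divr_ge0// ltW.
have incc : C x.1.2 a / alpha * D <= cbar / alpha * D.
  by rewrite ler_wpM2r// ler_wpM2r// invr_ge0 ltW.
split.
- by split=> /=; [rewrite addr_ge0// ltW|exact: addr_ge0].
- by rewrite /= lerDl.
- rewrite /discount /Defs.nxt /= -/D.
  apply: (@le_trans _ _ (expR (- alpha * (x.1.1 + y.1)) * cbar / alpha +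
    (x.2 + cbar / alpha * D))); first by rewrite lerD2l lerD2l.
  by rewrite /D le_eqVlt; apply/orP; left; apply/eqP; ring.
Qed.

Definition bracketed (v : state R -> R) :=
  forall x, Dom x -> Ulow x <= v x <= vbar x.

(** Stated for a number [r], so that it serves both for functions of the state and for
    history-dependent values [EU]. *)
Lemma bracket_widen x a y r : Dom x -> Ai x.1.2 a -> ~ null_set y ->
  Ulow (nxt x a y) <= r <= vbar (nxt x a y) -> Ulow x <= r <= vbar x.
Proof.
move=> Dx Aa Ny; have [Dn le1 le2] := Dom_nxt Dx Aa Ny.
move=> /andP[lo hi]; apply/andP; split.
  by apply: le_trans lo; apply: leU => //; case: Dx.
apply: le_trans hi _; apply: leU => //.
rewrite addr_ge0//; last by case: Dn.
by rewrite divr_ge0 ?mulr_ge0 ?expR_ge0// ltW.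
Qed.

Lemma bracketed_nxt v x a y : bracketed v -> Dom x -> Ai x.1.2 a ->
  ~ null_set y -> Ulow x <= v (nxt x a y) <= vbar x.
Proof.
move=> bv Dx Aa Ny; apply: (bracket_widen Dx Aa Ny).
by apply: bv; have [] := Dom_nxt Dx Aa Ny.
Qed.

Lemma bracketed_Ulow : bracketed Ulow.
Proof.
move=> x [t0 l0]; rewrite lexx/=; apply: leU => //.
by rewrite lerDr divr_ge0 ?mulr_ge0 ?expR_ge0// ltW.
Qed.

Lemma bracketed_vbar : bracketed vbar.
Proof. by move=> x Dx; rewrite lexx andbT; have /andP[] := bracketed_Ulow Dx. Qed.

Lemma vbar_sub_Ulow x : Dom x ->
  vbar x - Ulow x <= d * cbar / alpha * discount x.
Proof.
move=> [t0 l0]; apply: le_trans (lipU l0 _) _.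
  by rewrite lerDr divr_ge0 ?mulr_ge0 ?expR_ge0// ltW.
by rewrite addrK le_eqVlt; apply/orP; left; apply/eqP; rewrite /discount; ring.
Qed.

Lemma Qint_bracketed v x a : bracketed v -> Dom x -> Ai x.1.2 a ->
  Ulow x <= Qint v x a <= vbar x.
Proof.
move=> bv Dx Aa; apply: (Rintegral_bounds_offnull measurable_null (Q0 Aa)).
by move=> y Ny; exact: bracketed_nxt.
Qed.

Lemma le_Qint v w x a : bracketed v -> bracketed w ->
  (forall z, Dom z -> v z <= w z) -> Dom x -> Ai x.1.2 a ->
  Qint v x a <= Qint w x a.
Proof.
move=> bv bw vw Dx Aa.
apply: (@le_Rintegral_offnull _ _ _ _ _ measurable_null (Q0 Aa) _ _ (Ulow x) (vbar x)).
- by move=> y Ny; have /andP[] := bracketed_nxt bv Dx Aa Ny.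
- by move=> y Ny; apply: vw; have [] := Dom_nxt Dx Aa Ny.
- by move=> y Ny; have /andP[] := bracketed_nxt bw Dx Aa Ny.
Qed.

(** * The contraction estimate *)

Definition kappa : R := 1 - expR (- alpha * delta).
(** The expected discount over one step in the worst case, where the sojourn time is [delta] with
    probability [eps] and 0 otherwise. *)
Definition beta : R := 1 - eps * kappa.

Lemma kappa_bounds : 0 < kappa < 1.
Proof.
rewrite /kappa; have := expR_gt0 (- alpha * delta).
have : expR (- alpha * delta) < 1.
  by rewrite -expR0 ltr_expR mulNr oppr_lt0 mulr_gt0.
by lra.
Qed.

Lemma beta_bounds : 0 <= beta < 1.
Proof.
have /andP[k0 k1] := kappa_bounds; have [a Aa] := Ai0 0%N.
have e1 : eps <= 1.
  have := le_trans (measure_ge0 (Q 0%N a) _) (Qdelta Aa).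
  by rewrite lee_fin subr_ge0.
have : 0 < eps * kappa by rewrite mulr_gt0.
have : eps * kappa <= 1 by rewrite mulr_ile1// ltW.
by rewrite /beta; lra.
Qed.

Lemma measurable_discount : measurable_fun setT discount.
Proof.
apply: measurableT_comp => //; apply: measurable_funM => //.
exact: (measurableT_comp measurable_fst measurable_fst).
Qed.

(** The factor [expR (- alpha * y.1)] is at most 1 on the event [B] of sojourn time at most [delta],
    and at most [1 - kappa] off it; integrating with Q(B) at most [1 - eps] yields [beta]. *)
Lemma Qint_discount x a : Dom x -> Ai x.1.2 a ->
  Qint discount x a <= beta * discount x.
Proof.
move=> Dx Aa; have /andP[k0 k1] := kappa_bounds.
pose B : set (R * nat)%type := `]-oo, delta] `*` [set: nat].
have mB : measurable B by exact: measurableX.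
(* The summand 0 brings the integrand into the shape of [Rintegral_linear_offnull]. *)
have -> : Qint discount x a = \int[Q x.1.2 a]_y (0 + discount x * expR (- alpha * y.1)).
  apply: eq_Rintegral => y _.
  by rewrite add0r /discount -expRD; congr expR; rewrite /=; ring.
have mexp : measurable_fun (~` null_set) (fun y : (R * nat)%type => expR (- alpha * y.1)).
  apply: (@measurable_funS _ _ _ _ setT) => //.
  by apply: measurableT_comp => //; apply: measurable_funM.
have exp01 y : ~ null_set y -> 0 <= expR (- alpha * y.1) <= 1.
  move=> /not_null y0; rewrite expR_ge0/= -expR0 ler_expR.
  by rewrite mulNr oppr_le0 mulr_ge0 ?ltW.
rewrite (@Rintegral_linear_offnull _ _ _ _ _ measurable_null (Q0 Aa)
  (cst 0) _ _ 0 0 0 1)//; last by move=> *; rewrite lexx.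
rewrite Rintegral_probability_cst add0r mulrC ler_wpM2r//.
  exact: expR_ge0.
apply: (@le_trans _ _ (\int[Q x.1.2 a]_y ((1 - kappa) + kappa * \1_B y))).
  apply: (@le_Rintegral_offnull _ _ _ _ _ measurable_null (Q0 Aa) _ _ 0 1).
  - by move=> y /exp01/andP[].
  - move=> y Ny; rewrite indicE; have [yB|yB] := boolP (y \in B).
      by have /andP[_] := exp01 y Ny; rewrite mulr1; lra.
    rewrite mulr0 addr0 /kappa opprB addrC subrK ler_expR !mulNr lerN2 ler_pM2l//.
    rewrite leNgt; apply/negP => yd; move/negP: yB; apply; rewrite inE.
    by split => //=; rewrite in_itv/= ltW.
  - move=> y Ny; rewrite indicE; case: (_ \in _); rewrite ?mulr1 ?mulr0; lra.
rewrite (@Rintegral_linear_offnull _ _ _ _ _ measurable_null (Q0 Aa)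
  (cst (1 - kappa)) _ _ (1 - kappa) (1 - kappa) 0 1)//; first last.
- by move=> y _; rewrite indicE; case: (_ \in _); rewrite ?lexx ?ler01.
- by move=> y _; rewrite lexx.
rewrite Rintegral_probability_cst /Rintegral integral_indic// setIT.
have : fine (Q x.1.2 a B) <= 1 - eps.
  by rewrite -[leRHS]/(fine (1 - eps)%:E) fine_le ?Qdelta// fin_num_measure.
rewrite -(ler_pM2l k0) /beta; lra.
Qed.

Lemma measurable_Dom : measurable Dom.
Proof.
rewrite (_ : Dom = ((fst \o fst) @^-1` `[0, +oo[) `&` (snd @^-1` `[0, +oo[)).
  apply: measurableI; rewrite -[X in measurable X]setTI.
    by apply: (measurableT_comp measurable_fst measurable_fst) => //.
  exact: measurable_snd.
by apply/seteqP; split=> z /=; rewrite !in_itv/= !andbT.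
Qed.

(** Linearity is applied to [v] and [discount] only, and the passage to [w] is by monotonicity.
    Hence [w] can be any function of the transition, in particular an expectation [EU] along
    extended histories. *)
Lemma Qint_contract v w x a k M : measurable_fun Dom v -> bracketed v ->
  0 <= k -> Dom x -> Ai x.1.2 a ->
  (forall y, ~ null_set y ->
     v (nxt x a y) - k * discount (nxt x a y) <= w y <= M) ->
  Qint v x a - k * beta * discount x <= \int[Q x.1.2 a]_y w y.
Proof.
move=> mv bv k0 Dx Aa vw.
have mnxt : measurable_fun (~` null_set) (nxt x a).
  apply: (@measurable_funS _ _ _ _ setT) => //.
  apply: measurable_fun_pair; first apply: measurable_fun_pair => //.
    exact: measurable_funD.
  apply: measurable_funD => //; apply: measurable_funM => //.
  apply: measurable_funB => //; apply: measurableT_comp => //.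
  by apply: measurable_funM => //; exact: measurable_funD.
have mcomp u : measurable_fun Dom u ->
    measurable_fun (~` null_set) (fun y => u (nxt x a y)).
  move=> mu; apply: (measurable_comp measurable_Dom _ mu mnxt).
  by move=> _ [y Ny <-]; have [] := Dom_nxt Dx Aa Ny.
have disc01 y : ~ null_set y -> 0 <= discount (nxt x a y) <= 1.
  by move=> Ny; have [+ _ _] := Dom_nxt Dx Aa Ny => /discount_bounds.
apply: (@le_trans _ _ (Qint v x a + - k * Qint discount x a)).
  rewrite mulNr lerD2l lerN2 -mulrA ler_wpM2l//.
  exact: Qint_discount.
rewrite -(@Rintegral_linear_offnull _ _ _ _ _ measurable_null (Q0 Aa)
  _ _ _ (Ulow x) (vbar x) 0 1)//; first last.
- by move=> y Ny; exact: bracketed_nxt.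
- by apply: mcomp; apply: (@measurable_funS _ _ _ _ setT) => //; exact: measurable_discount.
- exact: mcomp.
apply: (@le_Rintegral_offnull _ _ _ _ _ measurable_null (Q0 Aa) _ _
  (Ulow x - k) M).
- move=> y Ny; have /andP[lo _] := bracketed_nxt bv Dx Aa Ny.
  have /andP[_ hi] := disc01 y Ny; rewrite mulNr lerB// ler_piMr//.
- by move=> y Ny; rewrite mulNr; have /andP[] := vw y Ny.
- by move=> y Ny; have /andP[] := vw y Ny.
Qed.

(** * Measurability of T *)

Let Dom_at i : set (state R) := Dom `&` [set x | x.1.2 = i].

Let measurable_current i : measurable [set x : state R | x.1.2 = i].
Proof.
rewrite (_ : [set x | _] = setT `&` (snd \o fst) @^-1` [set i]) ?setTI//.
rewrite -[X in measurable X]setTI.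
by apply: (measurableT_comp measurable_snd measurable_fst).
Qed.

Let measurable_Dom_at i : measurable (Dom_at i).
Proof.
by apply: measurableI; [exact: measurable_Dom|exact: measurable_current].
Qed.

Let bigcup_Dom_at : \bigcup_i Dom_at i = Dom.
Proof.
by apply/seteqP; split=> [x [i _ []]//|x Dx]; exists x.1.2.
Qed.

(** With state and action fixed the kernel is a single measure, so Tonelli applies. The integrand is
    shifted by [U 0] and cut off outside [E] to be nonnegative and measurable; the shift is added
    back since the total mass is 1. *)
Lemma measurable_Qint v i a : inB v -> Ai i a ->
  measurable_fun (Dom_at i) (fun x => Qint v x a).
Proof.
move=> [mv bv] Aa; pose c := C i a / alpha.
(* The transition with its cost coefficient frozen at [c]: jointly measurable, and equal to [nxt] on
   [E]. *)
pose nx (p : state R * (R * nat)%type) : state R :=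
  (p.1.1.1 + p.2.1, p.2.2,
   p.1.2 + c * (expR (- alpha * p.1.1.1) - expR (- alpha * (p.1.1.1 + p.2.1)))).
have mx : measurable_fun setT (fun p : state R * (R * nat)%type => p.1.1.1).
  by do 2 apply: (measurableT_comp measurable_fst).
have my : measurable_fun setT (fun p : state R * (R * nat)%type => p.2.1).
  by apply: (measurableT_comp measurable_fst).
have mnx : measurable_fun setT nx.
  apply: measurable_fun_pair; first apply: measurable_fun_pair.
  - exact: measurable_funD.
  - by apply: (measurableT_comp measurable_snd).
  apply: measurable_funD; first by apply: (measurableT_comp measurable_snd).
  apply: measurable_funM => //; apply: measurable_funB;
    apply: measurableT_comp => //; apply: measurable_funM => //.
  exact: measurable_funD.
pose E : set (state R * (R * nat)%type) := Dom_at i `*` ~` null_set.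
have mE : measurable E by apply: measurableX => //; exact: measurableC.
have Enx p : E p -> Dom (nx p) /\ nx p = nxt p.1 a p.2.
  case: p => x y [/= [Dx xi] Ny].
  have -> : nx (x, y) = nxt x a y by rewrite /nx /Defs.nxt /= xi.
  by split => //; have [] := @Dom_nxt x a y Dx _ Ny; rewrite ?xi.
pose h := (fun p => v (nx p) - U 0) \_ E.
have mh : measurable_fun setT h.
  apply/(measurable_restrictT _ mE); apply: measurable_funB => //.
  apply: (measurable_comp measurable_Dom _ mv).
    by move=> _ [p /Enx[Dp _] <-].
  exact: (@measurable_funS _ _ _ _ setT).
have h0 p : 0 <= h p.
  rewrite /h patchE; case: ifPn => // /set_mem /Enx[Dn _].
  have /andP[lo _] := bv _ Dn; rewrite subr_ge0 (le_trans _ lo)//.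
  by apply: leU => //; case: Dn.
have mF : measurable_fun setT (fubini_F (Q i a) (EFin \o h)).
  by apply: measurable_fun_fubini_tonelli_F => //; exact/measurable_EFinP.
apply/measurable_EFinP.
apply: (eq_measurable_fun (fun x => fubini_F (Q i a) (EFin \o h) x + (U 0)%:E)%E); last first.
  apply: emeasurable_funD => //; apply: (@measurable_funS _ _ _ _ setT) => //.
move=> x /set_mem[Dx xi]; have Aa' : Ai x.1.2 a by rewrite xi.
have hE y : ~ null_set y -> h (x, y) = v (nxt x a y) - U 0.
  move=> Ny; have Exy : E (x, y) by [].
  by rewrite /h patchE mem_set//; have [_ ->] := Enx _ Exy.
have hb y : ~ null_set y -> Ulow x - U 0 <= h (x, y) <= vbar x - U 0.
  by move=> Ny; rewrite hE// !lerD2r; exact: bracketed_nxt.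
rewrite /fubini_F -[in LHS](@fineK _ (\int[Q i a]_y _)%E); last first.
  by apply: (integral_fin_num_offnull measurable_null (Q0 Aa) hb).
rewrite -EFinD; congr EFin.
have -> : Qint v x a = \int[Q i a]_y (h (x, y) + U 0 * 1).
  rewrite /Qint /Defs.Qint xi.
  apply: (@eq_Rintegral_offnull _ _ _ _ _ measurable_null (Q0 Aa) _ _ (Ulow x) (vbar x)).
  - by move=> y Ny; exact: bracketed_nxt.
  - by move=> y Ny; rewrite hE// mulr1 subrK.
rewrite (@Rintegral_linear_offnull _ _ _ _ _ measurable_null (Q0 Aa)
  _ (cst 1) _ _ _ 1 1 _ _ hb)//; last 2 first.
- apply: (@measurable_funS _ _ _ _ setT) => //.
  exact: (measurableT_comp mh (pair1_measurable x)).
- by move=> y _; rewrite lexx.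
by rewrite Rintegral_probability_cst mulr1.
Qed.

Lemma measurable_Top v : inB v -> measurable_fun Dom (Top v).
Proof.
move=> vB; have [B [oB basisB]] := polish_basis polishP.
rewrite -bigcup_Dom_at; apply/measurable_fun_bigcup => // i.
apply: (eq_measurable_fun (fun x => inf [set Qint v x a | a in Ai i])).
  by move=> x /set_mem[_ xi]; rewrite /Top /Defs.Top xi.
apply: (measurable_fun_inf_compact basisB) => //.
  by move=> a Aa; exact: measurable_Qint.
by move=> x [Dx <-]; exact: cQint.
Qed.

Let measurable_U : measurable_fun (`[0, +oo[ : set R) U.
Proof. exact: subspace_continuous_measurable_fun. Qed.

Let inB_U_comp (g : state R -> R) : measurable_fun setT g ->
  (forall x, Dom x -> 0 <= g x) -> measurable_fun Dom (fun x => U (g x)).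
Proof.
move=> mg g0; apply: (@measurable_comp _ _ _ _ _ _ (`[0, +oo[ : set R) U) => //.
  by move=> _ [x Dx <-]; rewrite /= in_itv/= andbT g0.
exact: (@measurable_funS _ _ _ _ setT).
Qed.

Lemma inB_Ulow : inB Ulow.
Proof.
split; last exact: bracketed_Ulow.
by apply: inB_U_comp => [|x []].
Qed.

Lemma inB_vbar : inB vbar.
Proof.
split; last exact: bracketed_vbar.
apply: inB_U_comp => [|x [t0 l0]].
  apply: measurable_funD => //; do 2 apply: measurable_funM => //.
  exact: measurable_discount.
by rewrite addr_ge0// divr_ge0 ?mulr_ge0 ?expR_ge0// ltW.
Qed.

(** * Order properties of T *)

Let Qint_has_inf v x : bracketed v -> Dom x ->
  has_inf [set Qint v x a | a in Ai x.1.2].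
Proof.
move=> bv Dx; split.
  by have [a Aa] := Ai0 x.1.2; exists (Qint v x a), a.
by exists (Ulow x) => _ [a Aa <-]; have /andP[] := Qint_bracketed bv Dx Aa.
Qed.

Lemma Top_le_Qint v x a : bracketed v -> Dom x -> Ai x.1.2 a ->
  Top v x <= Qint v x a.
Proof.
by move=> bv Dx Aa; apply: ge_inf; [case: (Qint_has_inf bv Dx)|exists a].
Qed.

Lemma le_Top_Qint v x r : Dom x ->
  (forall a, Ai x.1.2 a -> r <= Qint v x a) -> r <= Top v x.
Proof.
move=> Dx rQ; have [a Aa] := Ai0 x.1.2.
apply: lb_le_inf; first by exists (Qint v x a), a.
by move=> _ [b Ab <-]; exact: rQ.
Qed.

Lemma Top_bracketed v : bracketed v -> bracketed (Top v).
Proof.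
move=> bv x Dx; have [a Aa] := Ai0 x.1.2; apply/andP; split.
  by apply: le_Top_Qint => // b Ab; have /andP[] := Qint_bracketed bv Dx Ab.
apply: le_trans (Top_le_Qint bv Dx Aa) _.
by have /andP[] := Qint_bracketed bv Dx Aa.
Qed.

Lemma Top_inB v : inB v -> inB (Top v).
Proof.
by move=> vB; split; [exact: measurable_Top|apply: Top_bracketed; case: vB].
Qed.

Lemma le_Top v w : bracketed v -> bracketed w ->
  (forall x, Dom x -> v x <= w x) -> forall x, Dom x -> Top v x <= Top w x.
Proof.
move=> bv bw vw x Dx; apply: le_Top_Qint => // a Aa.
by apply: le_trans (Top_le_Qint bv Dx Aa) _; exact: le_Qint.
Qed.

Lemma Top_contract v w k : inB v -> bracketed w -> 0 <= k ->
  (forall x, Dom x -> v x - k * discount x <= w x) ->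
  forall x, Dom x -> Top v x - k * beta * discount x <= Top w x.
Proof.
move=> [mv bv] bw k0 vw x Dx; apply: le_Top_Qint => // a Aa.
apply: le_trans (lerB (Top_le_Qint bv Dx Aa) (lexx _)) _.
apply: (@Qint_contract v (fun y => w (nxt x a y)) _ _ _ (vbar x)) => // y Ny.
have [Dn _ _] := Dom_nxt Dx Aa Ny; rewrite vw//=.
by have /andP[] := bracketed_nxt bw Dx Aa Ny.
Qed.

(** * Value iteration from the two bounds *)

Let lo n := iter n Top Ulow.
Let hi n := iter n Top vbar.
Let K : R := d * cbar / alpha.

(** The sign of [d] follows from the model: at time 0 the discount is 1, and [K] dominates the
    nonnegative gap between the two bounds. *)
Let K0 : 0 <= K.
Proof.
have D0 : Dom (0, 0%N, 0) by split => /=.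
have /andP[low _] := bracketed_vbar D0; have := vbar_sub_Ulow D0.
rewrite /discount /= mulr0 expR0 mulr1; apply: le_trans.
by rewrite subr_ge0.
Qed.

Let lo_inB n : inB (lo n).
Proof. by elim: n => [|n ih]; [exact: inB_Ulow|exact: Top_inB]. Qed.

Let hi_inB n : inB (hi n).
Proof. by elim: n => [|n ih]; [exact: inB_vbar|exact: Top_inB]. Qed.

Lemma iter_Ulow_nondecreasing x : Dom x ->
  nondecreasing_seq (fun n => iter n Top Ulow x).
Proof.
move=> Dx; apply/nondecreasing_seqP => n; elim: n x Dx => [|n ih] x Dx.
  by have /andP[] := (lo_inB 1).2 x Dx.
by apply: (le_Top (lo_inB n).2 (lo_inB n.+1).2).
Qed.

Lemma iter_vbar_nonincreasing x : Dom x ->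
  nonincreasing_seq (fun n => iter n Top vbar x).
Proof.
move=> Dx; apply/nonincreasing_seqP => n; elim: n x Dx => [|n ih] x Dx.
  by have /andP[] := (hi_inB 1).2 x Dx.
by apply: (le_Top (hi_inB n.+1).2 (hi_inB n).2).
Qed.

Let hi_lo n x : Dom x -> hi n x - K * beta ^+ n * discount x <= lo n x.
Proof.
elim: n x => [|n ih] x Dx.
  by rewrite expr0 mulr1 lerBlDr -lerBlDl; exact: vbar_sub_Ulow.
rewrite exprSr mulrA; apply: Top_contract => //; first exact: (lo_inB n).2.
by rewrite mulr_ge0// exprn_ge0//; have /andP[] := beta_bounds.
Qed.

Let contraction_cvg0 x : (fun n => K * beta ^+ n * discount x) @ \oo --> 0.
Proof.
have /andP[b0 b1] := beta_bounds.
rewrite -[X in _ --> X](mul0r (discount x)); apply: cvgMl.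
rewrite -[X in _ --> X](mulr0 K); apply: cvgMr.
by apply: cvg_expr; rewrite ger0_norm.
Qed.

Let Vstar x := limn (lo ^~ x).

Let lo_cvg x : Dom x -> lo ^~ x @ \oo --> Vstar x.
Proof.
move=> Dx; apply: nondecreasing_is_cvgn; first exact: iter_Ulow_nondecreasing.
exists (vbar x) => _ [n _ <-].
by have /andP[] := (lo_inB n).2 x Dx.
Qed.

Let lo_le_Vstar n x : Dom x -> lo n x <= Vstar x.
Proof.
move=> Dx; apply: (nondecreasing_cvgn_le (iter_Ulow_nondecreasing Dx)).
by apply: cvgP; exact: lo_cvg.
Qed.

Let lo_le_hi n x : Dom x -> lo n x <= hi n x.
Proof.
elim: n x => [|n ih] x Dx; first by have /andP[] := bracketed_vbar Dx.
by apply: (le_Top (lo_inB n).2 (hi_inB n).2).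
Qed.

Let hi_cvg x : Dom x -> hi ^~ x @ \oo --> Vstar x.
Proof.
move=> Dx; apply: (@squeeze_cvgr _ _ _ _ (lo ^~ x)
  (fun n => lo n x + K * beta ^+ n * discount x)).
- by near=> n; rewrite lo_le_hi//= -lerBlDr hi_lo.
- exact: lo_cvg.
- by rewrite -[X in _ --> X]addr0; apply: cvgD => //; exact: lo_cvg.
Unshelve. all: by end_near. Qed.

Let Vstar_le_hi n x : Dom x -> Vstar x <= hi n x.
Proof.
move=> Dx; rewrite -(cvg_lim _ (hi_cvg Dx))//.
apply: (nonincreasing_cvgn_ge (iter_vbar_nonincreasing Dx)).
by apply: cvgP; exact: hi_cvg.
Qed.

Let Vstar_inB : inB Vstar.
Proof.
split; last by move=> x Dx; rewrite (lo_le_Vstar 0)// (Vstar_le_hi 0).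
by apply: (measurable_fun_cvg (fun n => (lo_inB n).1) lo_cvg).
Qed.

(** Both the fixed point equation and its uniqueness reduce to this squeeze, since [Top] carries
    bounds by [lo n] and [hi n] to bounds by [lo n.+1] and [hi n.+1]. *)
Let unique_between w x : Dom x -> (forall n, lo n x <= w <= hi n x) ->
  w = Vstar x.
Proof.
move=> Dx lwh; apply/eqP; rewrite eq_le; apply/andP; split.
  by apply: (cvgr_to_ge (hi_cvg Dx)); near=> n; have /andP[] := lwh n.
by apply: (cvgr_to_le (lo_cvg Dx)); near=> n; have /andP[] := lwh n.
Unshelve. all: by end_near. Qed.

Let Vstar_fixpoint x : Dom x -> Vstar x = Top Vstar x.
Proof.
move=> Dx; apply/esym/unique_between => // -[|n].
  exact: Top_bracketed Vstar_inB.2 _ Dx.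
apply/andP; split.
  by apply: (le_Top (lo_inB n).2 Vstar_inB.2) => // z; exact: lo_le_Vstar.
by apply: (le_Top Vstar_inB.2 (hi_inB n).2) => // z; exact: Vstar_le_hi.
Qed.

Let Vstar_unique w : inB w -> (forall x, Dom x -> w x = Top w x) ->
  forall x, Dom x -> w x = Vstar x.
Proof.
move=> [_ bw] fixw x Dx; apply: unique_between => // n.
elim: n x Dx => [|n ih] x Dx; first exact: bw.
rewrite fixw//; apply/andP; split.
  by apply: (le_Top (lo_inB n).2 bw) => // z /ih /andP[].
by apply: (le_Top bw (hi_inB n).2) => // z /ih /andP[].
Qed.

(** * Expected utilities under policies *)

Local Notation EU := (EU Q C alpha U).
Local Notation Vpi := (Vpi Q C alpha U).

Lemma EU_bracketed (pi : policy P) m n (h : hist P n) : admissible Ai pi ->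
  Dom h.2 -> Ulow h.2 <= EU pi m h <= vbar h.2.
Proof.
move=> api; elim: m n h => [|m ih] n h Dh; first exact: bracketed_Ulow.
have Aa := (api n).2 h.
apply: (Rintegral_bounds_offnull measurable_null (Q0 Aa)) => y Ny.
apply: (bracket_widen Dh Aa Ny); apply: (ih _ (ext C alpha h (pi n h) y)).
by have [] := Dom_nxt Dh Aa Ny.
Qed.

Lemma EU_ext_bracketed (pi : policy P) m n (h : hist P n) y :
  admissible Ai pi -> Dom h.2 -> ~ null_set y ->
  Ulow h.2 <= EU pi m (ext C alpha h (pi n h) y) <= vbar h.2.
Proof.
move=> api Dh Ny; have Aa := (api n).2 h; apply: (bracket_widen Dh Aa Ny).
apply: (@EU_bracketed pi m _ (ext C alpha h (pi n h) y)) => //.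
by have [] := Dom_nxt Dh Aa Ny.
Qed.

(** Costs only accumulate, which gives the first step; the rest is monotonicity of the integral.
    With the upper bound [vbar], this makes the [lim] in [Vpi] a true limit. *)
Lemma EU_nondecreasing (pi : policy P) n (h : hist P n) : admissible Ai pi ->
  Dom h.2 -> nondecreasing_seq (fun m => EU pi m h).
Proof.
move=> api Dh; apply/nondecreasing_seqP => m; elim: m n h Dh => [|m ih] n h Dh.
  by have /andP[] := EU_bracketed 1 api Dh.
have Aa := (api n).2 h.
apply: (@le_Rintegral_offnull _ _ _ _ _ measurable_null (Q0 Aa) _ _
  (Ulow h.2) (vbar h.2)) => y Ny.
- by have /andP[] := EU_ext_bracketed m api Dh Ny.
- apply: (ih _ (ext C alpha h (pi n h) y)).
  by have [] := Dom_nxt Dh Aa Ny.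
- by have /andP[] := EU_ext_bracketed m.+1 api Dh Ny.
Qed.

Lemma EU_cvg (pi : policy P) x : admissible Ai pi -> Dom x ->
  (fun m => EU pi m (hist0 P x)) @ \oo --> Vpi pi x.
Proof.
move=> api Dx; apply: nondecreasing_is_cvgn; first exact: EU_nondecreasing.
exists (vbar x) => _ [m _ <-].
by have /andP[] := EU_bracketed m (h := hist0 P x) api Dx.
Qed.

(** The infimum in [Top] is at most the integral at the action chosen by [pi]. The induction runs
    over all histories because later actions may depend on the whole past. *)
Lemma iter_Ulow_le_EU (pi : policy P) m n (h : hist P n) : admissible Ai pi ->
  Dom h.2 -> iter m Top Ulow h.2 <= EU pi m h.
Proof.
move=> api; elim: m n h => [|m ih] n h Dh //; have Aa := (api n).2 h.
apply: le_trans (Top_le_Qint (lo_inB m).2 Dh Aa) _.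
apply: (@le_Rintegral_offnull _ _ _ _ _ measurable_null (Q0 Aa) _ _
  (Ulow h.2) (vbar h.2)) => y Ny.
- by have /andP[] := bracketed_nxt (lo_inB m).2 Dh Aa Ny.
- apply: (ih _ (ext C alpha h (pi n h) y)).
  by have [] := Dom_nxt Dh Aa Ny.
- by have /andP[] := EU_ext_bracketed m api Dh Ny.
Qed.

Let Vstar_le_Vpi (pi : policy P) x : admissible Ai pi -> Dom x ->
  Vstar x <= Vpi pi x.
Proof.
move=> api Dx; apply: (ler_cvg_to (lo_cvg Dx) (EU_cvg api Dx)).
by near=> n; exact: (iter_Ulow_le_EU n (h := hist0 P x)).
Unshelve. all: by end_near. Qed.

Lemma stationary_admissible f : inF Ai f -> admissible Ai (stationary f).
Proof.
move=> [mf Af] n; split=> [|h]; last exact: Af.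
exact: (measurableT_comp mf measurable_snd).
Qed.

Let Vf_minimizer f : inF Ai f ->
  (forall x, Dom x -> Top Vstar x = Tf Q C alpha f Vstar x) ->
  forall x, Dom x -> Vpi (stationary f) x = Vstar x.
Proof.
move=> Ff minf x Dx; have af := stationary_admissible Ff.
have QintE z : Dom z -> Qint Vstar z (f z) = Vstar z.
  by move=> Dz; rewrite [RHS]Vstar_fixpoint// minf.
(* For [m = 0] the error [K * discount] covers the whole gap between [Ulow] and [vbar]. Each further
   step keeps [Vstar] unchanged, as [f] attains the minimum, and multiplies the error by [beta]. *)
have EUbounds m n (h : hist P n) : Dom h.2 ->
    Vstar h.2 - K * beta ^+ m * discount h.2 <= EU (stationary f) m h <= Vstar h.2.
  elim: m n h => [|m ih] n h Dh.
    rewrite expr0 mulr1 (lo_le_Vstar 0)// andbT lerBlDr -lerBlDl.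
    apply: le_trans _ (vbar_sub_Ulow Dh).
    by rewrite lerB//; exact: (Vstar_le_hi 0).
  have Aa := Ff.2 h.2; rewrite -(QintE _ Dh); apply/andP; split.
    rewrite exprSr mulrA.
    apply: (Qint_contract (M := vbar h.2)) => //; [exact: Vstar_inB.1|exact: Vstar_inB.2| |].
      by rewrite mulr_ge0// exprn_ge0//; have /andP[] := beta_bounds.
    move=> y Ny; have [Dn _ _] := Dom_nxt Dh Aa Ny.
    have /andP[lo' hi'] := ih _ (ext C alpha h (f h.2) y) Dn.
    rewrite lo'/= (le_trans hi')//.
    by have /andP[] := bracketed_nxt Vstar_inB.2 Dh Aa Ny.
  apply: (@le_Rintegral_offnull _ _ _ _ _ measurable_null (Q0 Aa) _ _
    (Ulow h.2) (vbar h.2)) => y Ny; have [Dn _ _] := Dom_nxt Dh Aa Ny.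
  - by have /andP[] := EU_ext_bracketed m af Dh Ny.
  - by have /andP[] := ih _ (ext C alpha h (f h.2) y) Dn.
  - by have /andP[] := bracketed_nxt Vstar_inB.2 Dh Aa Ny.
have : (fun m => EU (stationary f) m (hist0 P x)) @ \oo --> Vstar x.
  apply: (@squeeze_cvgr _ _ _ _ (fun m => Vstar x - K * beta ^+ m * discount x)
    (cst (Vstar x))).
  - by near=> m; exact: (EUbounds m 0%N (hist0 P x)).
  - by rewrite -[X in _ --> X]subr0; apply: cvgB => //; exact: cvg_cst.
  - exact: cvg_cst.
by move=> /cvg_lim; apply.
Unshelve. all: by end_near. Qed.

(** * Existence of a minimizer and identification of the optimal value *)

Lemma exists_minimizer v : inB v -> exists f, inF Ai f /\
  forall x, Dom x -> Top v x = Tf Q C alpha f v x.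
Proof.
move=> vB; have [B [oB basisB]] := polish_basis polishP.
have [F FP] : {F : nat -> state R -> P & forall i,
    (forall x, Dom_at i x -> Ai i (F i x) /\
       forall b, Ai i b -> Qint v x (F i x) <= Qint v x b) /\
    (forall V, open V -> measurable (Dom_at i `&` F i @^-1` V))}.
  apply: (@choice _ _ (fun i f =>
    (forall x, Dom_at i x -> Ai i (f x) /\
       forall b, Ai i b -> Qint v x (f x) <= Qint v x b) /\
    (forall V, open V -> measurable (Dom_at i `&` f @^-1` V)))) => i.
  apply: (measurable_minimizer oB basisB polishP.1) => //.
    by move=> a Aa; exact: measurable_Qint.
  by move=> x [Dx <-]; exact: cQint.
have [a aP] : {a : nat -> P & forall i, Ai i (a i)}.
  by apply: (@choice _ _ (fun i c => Ai i c)) => i; exact: Ai0.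
(* The selections on the countably many slices [Dom_at i] are glued. Since [inF] asks for
   admissibility and measurability everywhere, a fixed admissible action per state fills in outside
   [Dom]. *)
pose f x := if pselect (Dom x) then F x.1.2 x else a x.1.2.
have fDom x : Dom x -> f x = F x.1.2 x by rewrite /f; case: pselect.
have fNDom x : ~ Dom x -> f x = a x.1.2 by rewrite /f; case: pselect.
exists f; split; first split.
- apply: (@measurability _ _ _ (borel P) _ _ (@open P)) => // _ [V oV <-]; rewrite setTI.
  rewrite (_ : f @^-1` V = \bigcup_i ((Dom_at i `&` F i @^-1` V) `|`
    ((~` Dom `&` [set x | x.1.2 = i]) `&` [set _ | V (a i)]))).
    apply: bigcupT_measurable => i; apply: measurableU.
      by have [_] := FP i; apply.
    apply: measurableI.
      apply: measurableI; last exact: measurable_current.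
      by apply: measurableC; exact: measurable_Dom.
    have [Va|Va] := pselect (V (a i)).
      by rewrite (_ : [set _ | _] = setT)//; apply/seteqP; split.
    by rewrite (_ : [set _ | _] = set0)//; apply/seteqP; split.
  apply/seteqP; split=> [x Vfx|x [i _ [[[Dx xi] Vx]|[[Dx xi] Va]]]].
  + exists x.1.2 => //; have [Dx|Dx] := pselect (Dom x).
      by left; split => //; rewrite /preimage/= -fDom.
    by right; split => //; rewrite /= -(fNDom _ Dx).
  + by rewrite /preimage /= fDom// xi.
  + by rewrite /preimage /= fNDom// xi.
- move=> x; have [Dx|Dx] := pselect (Dom x); last by rewrite fNDom.
  by rewrite fDom//; have [+ _] := FP x.1.2 => /(_ x)[].
- move=> x Dx; rewrite /Tf fDom//.
  have [+ _] := FP x.1.2 => /(_ x)[//|Ax minx].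
  apply/eqP; rewrite eq_le Top_le_Qint//=; last exact: vB.2.
  exact: le_Top_Qint.
Qed.

Let optimal_stationary : exists f, [/\ inF Ai f,
  forall x, Dom x -> Top Vstar x = Tf Q C alpha f Vstar x &
  forall x, Dom x -> Vf Q C alpha U f x = Vstar x].
Proof.
have [f [Ff minf]] := exists_minimizer Vstar_inB.
by exists f; split => //; exact: Vf_minimizer.
Qed.

(** [Vstar] is a lower bound for the value of every policy, and the stationary policy of a minimizer
    attains it. *)
Let VinfE x : Dom x -> Vinf x = Vstar x.
Proof.
move=> Dx; have [f [Ff _ Vfx]] := optimal_stationary.
have af := stationary_admissible Ff.
apply/eqP; rewrite eq_le; apply/andP; split.
  rewrite -(Vfx x Dx); apply: ge_inf; last by exists (stationary f).
  by exists (Vstar x) => _ [pi api <-]; exact: Vstar_le_Vpi.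
apply: lb_le_inf; first by exists (Vpi (stationary f) x), (stationary f).
by move=> _ [pi api <-]; exact: Vstar_le_Vpi.
Qed.

Let Vinf_inB : inB Vinf.
Proof.
split; last by move=> x Dx; rewrite VinfE//; exact: Vstar_inB.2.
apply: (eq_measurable_fun Vstar); last exact: Vstar_inB.1.
by move=> x /set_mem Dx; rewrite VinfE.
Qed.

(** [Vinf] and [Vstar] are known to agree only on [Dom], so the equality is transferred by
    monotonicity in both directions. *)
Let Top_Vinf x : Dom x -> Top Vinf x = Top Vstar x.
Proof.
move=> Dx; apply/eqP; rewrite eq_le; apply/andP; split;
  apply: le_Top => //; try exact: Vinf_inB.2; try exact: Vstar_inB.2;
  by move=> z Dz; rewrite VinfE.
Qed.

Let Qint_Vinf x a : Dom x -> Ai x.1.2 a -> Qint Vinf x a = Qint Vstar x a.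
Proof.
move=> Dx Aa; apply/eqP; rewrite eq_le; apply/andP; split;
  apply: le_Qint => //; try exact: Vinf_inB.2; try exact: Vstar_inB.2;
  by move=> z Dz; rewrite VinfE.
Qed.

Lemma value_iteration :
  (inB Vinf
   /\ (forall x, Dom x -> Vinf x = Top Vinf x)
   /\ (forall w, inB w -> (forall x, Dom x -> w x = Top w x) ->
         forall x, Dom x -> w x = Vinf x)
   /\ (forall x, Dom x ->
         nondecreasing_seq (fun n => iter n Top Ulow x)
         /\ (fun n => iter n Top Ulow x) @ \oo --> Vinf x)
   /\ (forall x, Dom x ->
         nonincreasing_seq (fun n => iter n Top vbar x)
         /\ (fun n => iter n Top vbar x) @ \oo --> Vinf x))
  /\
  (exists fstar : state R -> P,
     inF Ai fstar
     /\ (forall x, Dom x -> Top Vinf x = Tf Q C alpha fstar Vinf x)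
     /\ (forall x, Dom x -> Vf Q C alpha U fstar x = Vinf x)
     /\ (forall i, Vf Q C alpha U fstar (0, i, 0) = Jinf Ai Q C alpha U i)).
Proof.
split.
  split; first exact: Vinf_inB.
  split; first by move=> x Dx; rewrite Top_Vinf// VinfE// -Vstar_fixpoint.
  split; first by move=> w wB fixw x Dx; rewrite VinfE//; exact: Vstar_unique.
  split=> x Dx; rewrite VinfE//.
    by split; [exact: iter_Ulow_nondecreasing|exact: lo_cvg].
  by split; [exact: iter_vbar_nonincreasing|exact: hi_cvg].
have [f [Ff minf Vfx]] := optimal_stationary; exists f; split => //.
split; first by move=> x Dx; rewrite Top_Vinf// minf// /Tf Qint_Vinf//; exact: Ff.2.
split=> [x Dx|i]; first by rewrite Vfx// VinfE.
by rewrite /Jinf Vfx ?VinfE.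
Qed.

End smdp.

Unset Implicit Arguments.
Set Strict Implicit.

Theorem theorem4p1 (R : realType) (P : completePseudoMetricType R)
  (A : set P) (Ai : nat -> set P)
  (Q : nat -> P -> probability (R * nat)%type R)
  (C : nat -> P -> R) (alpha cbar : R) (U : R -> R) :
  (* the action space A is a Borel subset of the Polish space P *)
  polish P ->
  measurable (A : set (borel P)) ->
  (* admissible action sets: nonempty Borel subsets of A *)
  (forall i, Ai i `<=` A) ->
  (forall i, measurable (Ai i : set (borel P))) ->
  (forall i, Ai i !=set0) ->
  (* Q is a semi-Markov kernel on [0,oo) x E given K with Q(0, j | i, a) = 0 *)
  (forall i (B : set (R * nat)%type), measurable B ->
     measurable_fun (Ai i : set (borel P)) (fun a : borel P => (Q i a B : \bar R))) ->
  (forall i a, Ai i a -> Q i a (`]-oo, 0%R] `*` [set: nat]) = 0%E) ->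
  (* running cost, discount factor *)
  0 < cbar -> 0 < alpha ->
  (forall i, measurable_fun (Ai i : set (borel P)) (C i : borel P -> R)) ->
  (forall i a, Ai i a -> 0 <= C i a <= cbar) ->
  (* utility: continuous, strictly increasing, concave on [0,oo), U'(0) exists *)
  {within `[0%R, +oo[, continuous U} ->
  (forall x y, 0 <= x -> x < y -> U x < U y) ->
  (forall x y l, 0 <= x -> 0 <= y -> 0 <= l <= 1 ->
     l * U x + (1 - l) * U y <= U (l * x + (1 - l) * y)) ->
  (exists d : R, (fun h => (U h - U 0) / h) @ 0%R^'+ --> d) ->
  (* Assumption 1 *)
  (exists delta eps : R, 0 < delta /\ 0 < eps /\
     forall i a, Ai i a -> (Q i a (`]-oo, delta] `*` [set: nat]) <= (1 - eps)%:E)%E) ->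
  (* Assumption 2 *)
  (forall i, compact (Ai i)) ->
  (forall i, {within Ai i, continuous (C i)}) ->
  (forall v, inB alpha cbar U v ->
     forall x, Dom x -> {within Ai x.1.2, continuous (Qint Q C alpha v x)}) ->
  (* (a) *)
  (inB alpha cbar U (Vinf Ai Q C alpha U)
   /\ (forall x, Dom x ->
         Vinf Ai Q C alpha U x = Top Ai Q C alpha (Vinf Ai Q C alpha U) x)
   /\ (forall w, inB alpha cbar U w ->
         (forall x, Dom x -> w x = Top Ai Q C alpha w x) ->
         forall x, Dom x -> w x = Vinf Ai Q C alpha U x)
   /\ (forall x, Dom x ->
         nondecreasing_seq (fun n => iter n (Top Ai Q C alpha) (Ulow U) x)
         /\ (fun n => iter n (Top Ai Q C alpha) (Ulow U) x) @ \oo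
              --> Vinf Ai Q C alpha U x)
   /\ (forall x, Dom x ->
         nonincreasing_seq (fun n => iter n (Top Ai Q C alpha) (vbar alpha cbar U) x)
         /\ (fun n => iter n (Top Ai Q C alpha) (vbar alpha cbar U) x) @ \oo
              --> Vinf Ai Q C alpha U x))
  /\
  (* (b) *)
  (exists fstar : state R -> P,
     inF Ai fstar
     /\ (forall x, Dom x ->
           Top Ai Q C alpha (Vinf Ai Q C alpha U) x
           = Tf Q C alpha fstar (Vinf Ai Q C alpha U) x)
     /\ (forall x, Dom x -> Vf Q C alpha U fstar x = Vinf Ai Q C alpha U x)
     /\ (forall i, Vf Q C alpha U fstar (0, i, 0) = Jinf Ai Q C alpha U i)).
Proof.
move=> polishP _ _ _ Ai0 _ Q0 cbar0 alpha0 _ C_bounds cU incrU concU [d dU].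
move=> [delta [eps [delta0 [eps0 Qdelta]]]] compactAi _ cQint.
exact: (value_iteration polishP Ai0 Q0 cbar0 alpha0 C_bounds cU incrU
  (concave_lipschitz concU dU) delta0 eps0 Qdelta compactAi cQint).
Qed.
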